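(* Let $E$ be a real Banach space and let $K$ be a nonempty closed convex subset of $E$ which is also a nonexpansive retract of $E$ with nonexpansive retraction $P:E\to K$. Let $T_1,T_2:K\to E$ be two continuous nonself total asymptotically nonexpansive mappings with sequences $\{\mu_n\},\{\lambda_n\}$ and function $\phi$, such that $\sum_{n=1}^\infty \mu_n<\infty$ and $\sum_{n=1}^\infty\lambda_n<\infty$. Suppose that there exist $M,M^*>0$ such that $\phi(\kappa)\le M^*\kappa$ for all $\kappa\ge M$. Suppose that $\{\alpha_n\}$ and $\{\beta_n\}$ are two real sequences in $[0,1]$, that $F=F(T_1)\cap F(T_2)\neq\emptyset$, and that $\{x_n\}$ is defined by $x_1\in K$ and, for $n\in\mathbb{N}$, $$x_{n+1}=(1-\alpha_n)(PT_1)^n y_n+\alpha_n (PT_2)^n y_n,\qquad y_n=(1-\beta_n)x_n+\beta_n(PT_1)^n x_n .$$ Then $\{x_n\}$ converges strongly to a common fixed point of $T_1$ and $T_2$ if and only if $\liminf_{n\to\infty} d(x_n,F)=0$.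
   Context: A nonexpansive retraction $P:E\to K$ of $E$ onto $K$ is a nonexpansive map ($\|Px-Py\|\le\|x-y\|$) with $Px=x$ for all $x\in K$. For $T:K\to E$, $PT:K\to K$ is the composition $x\mapsto P(Tx)$ and $(PT)^n$ is its $n$-th iterate. Fixed point sets: $F(T)=\{x\in K: Tx=x\}$, and $d(x,F)=\inf_{p\in F}\|x-p\|$. A nonself mapping $T:K\to E$ is called total asymptotically nonexpansive (with sequences $\{\mu_n\},\{\lambda_n\}$ and function $\phi$) if $\{\mu_n\},\{\lambda_n\}$ are nonnegative real sequences with $\mu_n,\lambda_n\to0$ as $n\to\infty$, $\phi:\mathbb{R}\to\mathbb{R}$ is a strictly increasing continuous function with $\phi(0)=0$, and $$\|(PT)^n x-(PT)^n y\|\le \|x-y\|+\mu_n\phi(\|x-y\|)+\lambda_n\quad\text{for all }x,y\in K,\ n\ge1.$$ When two mappings $T_1,T_2$ are considered, both satisfy this inequality with the same $\{\mu_n\},\{\lambda_n\},\phi$. *)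

(* Defs.v *)
From mathcomp Require Import all_boot all_order all_algebra.
From mathcomp Require Import all_classical all_reals all_analysis.

Set Implicit Arguments.
Unset Strict Implicit.
Unset Printing Implicit Defensive.

Import Order.TTheory GRing.Theory Num.Theory.
Import numFieldNormedType.Exports.

Local Open Scope classical_set_scope.
Local Open Scope ring_scope.

(* A nonself mapping T : K -> E is represented by a total function T : E -> E
   whose values outside K are never constrained or used.  Sequences indexed by
   the positive integers are functions on nat whose value at 0 is likewise
   irrelevant. *)

Definition nonexpansive_retraction (R : realType) (E : normedModType R)
    (K : set E) (P : E -> E) : Prop :=
  [/\ set_fun [set: E] K P,
      forall x y : E, `|P x - P y| <= `|x - y|
    & forall x : E, K x -> P x = x].

Definition fixed_points (R : realType) (E : normedModType R)
    (K : set E) (T : E -> E) : set E :=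
  [set x | K x /\ T x = x].

(* Extended-real valued so that the infimum is also meaningful for A = set0
   and so that limit inferiors of distances always exist. *)
Definition dist_to_set (R : realType) (E : normedModType R)
    (x : E) (A : set E) : \bar R :=
  ereal_inf [set `|x - p|%:E | p in A].

(* On K, iter n (P \o T) is the n-th iterate of PT : K -> K: when P maps into K
   the iterates of a point of K stay in K. *)
Definition total_asymptotically_nonexpansive (R : realType)
    (E : normedModType R) (K : set E) (P : E -> E)
    (mu lambda : nat -> R) (phi : R -> R) (T : E -> E) : Prop :=
  [/\ forall n, (1 <= n)%N -> 0 <= mu n /\ 0 <= lambda n,
      mu @ \oo --> (0 : R) /\ lambda @ \oo --> (0 : R),
      [/\ {homo phi : s t / s < t}, continuous phi & phi 0 = 0]
    & forall (n : nat) (x y : E), (1 <= n)%N -> K x -> K y ->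
        `|iter n (P \o T) x - iter n (P \o T) y|
          <= `|x - y| + mu n * phi `|x - y| + lambda n].

(* Main.v *)
(* For p in F, the growth condition on phi gives phi t <= phi M + Mstar t for
   t >= 0, so that each step of the iteration satisfies
     |x_(n+1) - p| <= (1 + a)^2 |x_n - p| + (2 + a) w
   with a = Mstar mu_n and w = mu_n phi(M) + lambda_n.  As (1 + a)^2 <= e^(2a),
   the right-hand side is at most e^(2a) (|x_n - p| + 2w).  Summability then
   yields a constant D, independent of p, with
   |x_m - p| <= D (|x_n - p| + tail_n) for m >= n: once some x_n is close to
   a point p of F, the whole tail of the sequence is.  Hence the sequence is
   Cauchy, and its limit lies in the closed set F. *)
Require Import Defs.
From mathcomp Require Import all_boot all_order all_algebra.
From mathcomp Require Import all_classical all_reals all_analysis.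
From mathcomp Require Import ring lra.

Set Implicit Arguments.
Unset Strict Implicit.
Unset Printing Implicit Defensive.

Import Order.TTheory GRing.Theory Num.Theory.
Import numFieldNormedType.Exports.
Local Open Scope classical_set_scope.
Local Open Scope ring_scope.

(** * Limits in closed sets *)

Lemma closed_fixed_points (R : realType) (E : normedModType R)
    (K : set E) (T : E -> E) :
  closed K -> {within K, continuous T} -> closed (fixed_points K T).
Proof.
move=> cK cT q clq.
have Kq : K q by apply: cK => B /clq [z [[Kz _] Bz]]; exists z.
split=> //; apply/eqP; rewrite -subr_eq0 -normr_le0; apply/ler_addgt0Pr => e e0.
have e20 : 0 < e / 2 by rewrite divr_gt0.
(* Continuity relative to [K] controls [T z] only for [z] in [K]. A fixed point [z] near [q] lies in
   [K], and [T z = z] lets [T q] be compared with [q] through [z]. *)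
have /cvgrPdist_lt/(_ _ e20) : T @ within K (nbhs q) --> T q.
  by rewrite nbhs_subspace_in//; exact: cT.
rewrite near_withinE => near_T.
have near_q : \forall z \near q, `|q - z| < e / 2.
  by have /cvgrPdist_lt/(_ _ e20) : z @[z --> q] --> q by exact: cvg_id.
have [z [[Kz Tz] [/(_ Kz) Tqz qz]]] := clq _ (filterI near_T near_q).
rewrite add0r; apply: ltW.
rewrite (_ : T q - q = (T q - T z) - (q - z)); last first.
  by rewrite Tz opprB addrA subrK.
by rewrite (le_lt_trans (ler_normB _ _))// (splitr e) ltrD.
Qed.

(** Small balls that eventually contain [u] make it Cauchy. Their centres lie in [A] and are
    arbitrarily close to the limit, which is thus in the closure of [A]. *)
Lemma closed_cauchy_cvg (R : realType) (E : completeNormedModType R)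
    (A : set E) (u : nat -> E) :
  closed A ->
  (forall e : R, 0 < e ->
    exists2 p, A p & \forall n \near \oo, `|p - u n| < e) ->
  exists2 q, A q & u @ \oo --> q.
Proof.
move=> cA uA.
have : cauchy (u @ \oo).
  apply: cauchy_exP => e /uA [p _ up]; exists p.
  by near do rewrite -ball_normE/=.
move=> /cauchy_cvg /cvg_ex [q uq]; exists q => //; apply: cA => B.
rewrite -nbhs_ballE => -[e /= e0 qeB].
have e20 : 0 < e / 2 by rewrite divr_gt0.
have [p Ap up] := uA _ e20; exists p; split=> //; apply: qeB.
have /cvgrPdist_lt/(_ _ e20) uq' := uq.
have [n [pn qn]] := filter_ex (filterI up uq').
rewrite -ball_normE/= (_ : q - p = (q - u n) - (p - u n)); last first.
  by rewrite opprB addrA subrK.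
by rewrite (le_lt_trans (ler_normB _ _))// (splitr e) ltrD.
Unshelve. all: by end_near. Qed.

(** * Summable nonnegative series *)

Lemma nneseries_lt_pinfty_ub (R : realType) (u : nat -> R) m :
  (forall n, (m <= n)%N -> 0 <= u n) ->
  (\sum_(m <= n <oo) (u n)%:E < +oo)%E ->
  exists B, forall n, \sum_(m <= k < n) u k <= B.
Proof.
move=> u0 uoo; set S := (\sum_(m <= n <oo) _)%E in uoo.
have u0' n : (m <= n)%N -> true -> (0 <= (u n)%:E)%E.
  by move=> mn _; rewrite lee_fin u0.
have S0 : (0 <= S)%E by exact: nneseries_ge0.
have Sfin : S \is a fin_num by rewrite ge0_fin_numE.
exists (fine S) => n; rewrite -lee_fin fineK// -sumEFin.
exact: nneseries_lim_ge.
Qed.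

(** The partial sums increase to a limit, and the sum over any block starting at [n] is at most that
    limit minus the [n]-th partial sum, whatever the end [p]. *)
Lemma bounded_sum_tail (R : realType) (u : nat -> R) m B (e : R) :
  (forall n, (m <= n)%N -> 0 <= u n) ->
  (forall n, \sum_(m <= k < n) u k <= B) ->
  0 < e ->
  exists2 N, (m <= N)%N &
    forall n p, (N <= n)%N -> \sum_(n <= k < p) u k < e.
Proof.
move=> u0 uB e0; pose S n := \sum_(m <= k < n) u k.
have S_incr n p : (n <= p)%N -> S n <= S p.
  move=> np; have [pm|mp] := leqP p m.
    by rewrite /S !big_geq//; exact: leq_trans np pm.
  have [mn|nm] := leqP m n.
    rewrite /S (big_cat_nat mn np)/= lerDl big_nat.
    by apply: sumr_ge0 => k /andP[nk _]; rewrite u0// (leq_trans mn).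
  rewrite {1}/S (big_geq (ltnW nm)) /S big_nat.
  by apply: sumr_ge0 => k /andP[mk _]; rewrite u0.
have S_cvg : cvgn S.
  by apply: nondecreasing_is_cvgn => //; exists B => _ [n _ <-]; exact: uB.
have /cvgrPdist_lt/(_ _ e0) [N _ S_near] : S @ \oo --> limn S by [].
exists (maxn m N) => [|n p]; first exact: leq_maxl.
rewrite geq_max => /andP[mn Nn].
have [pn|/ltnW np] := leqP p n; first by rewrite big_geq.
have := S_near n Nn; rewrite /= => /(le_lt_trans (ler_norm _)).
apply: le_lt_trans.
have := nondecreasing_cvgn_le S_incr S_cvg p.
by rewrite {1}/S (big_cat_nat mn np)/= -/(S n) => ?; rewrite lerBrDl.
Qed.

(** * Recursive inequalities and distances to a set *)

Lemma expR_recursion_bound (R : realType) (d a c : nat -> R) m n :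
  (forall k, (m <= k)%N -> 0 <= a k) ->
  (forall k, (m <= k)%N -> 0 <= c k) ->
  (forall k, (m <= k)%N -> d k.+1 <= expR (a k) * (d k + c k)) ->
  (m <= n)%N ->
  d n <= expR (\sum_(m <= k < n) a k) * (d m + \sum_(m <= k < n) c k).
Proof.
move=> a0 c0 dS; elim: n => [|n IHn].
  by rewrite leqn0 => /eqP ->; rewrite !big_geq// expR0 mul1r addr0.
rewrite leq_eqVlt => /orP[/eqP <-|]; first by rewrite !big_geq// expR0 mul1r addr0.
rewrite ltnS => mn; rewrite (le_trans (dS _ mn))// !big_nat_recr//=.
rewrite [X in _ <= expR X * _]addrC expRD -mulrA ler_pM2l ?expR_gt0//.
(* The new term [c n] carries only the factor [expR (a n)]. Multiplying it by the earlier
   exponential, which is at least 1, puts it under the common product. *)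
rewrite addrA mulrDr lerD ?IHn// ler_peMl ?c0//.
rewrite -expR0 ler_expR big_nat; apply: sumr_ge0 => k /andP[mk _]; exact: a0.
Qed.

(** The bounds [A] and [C] do not depend on [p], so [p] may be chosen after the index [n] at which
    the sequence comes close to [F]; the recursion is then restarted from [n]. *)
Lemma quasi_fejer_cvg (R : realType) (E : completeNormedModType R)
    (F : set E) (x : nat -> E) (a c : nat -> R) m A C :
  closed F ->
  (forall n, (m <= n)%N -> 0 <= a n) ->
  (forall n, (m <= n)%N -> 0 <= c n) ->
  (forall n, \sum_(m <= k < n) a k <= A) ->
  (forall n, \sum_(m <= k < n) c k <= C) ->
  (forall n p, (m <= n)%N -> F p ->
    `|x n.+1 - p| <= expR (a n) * (`|x n - p| + c n)) ->
  limn_einf (fun n => dist_to_set (x n) F) = 0%E ->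
  exists2 p, F p & x @ \oo --> p.
Proof.
move=> cF a0 c0 aA cC xS inf0; apply: closed_cauchy_cvg => // e e0.
have D0 : 0 < expR A by exact: expR_gt0.
(* One [r] is spent on [|x n - p|], the other on the tail of [c]; the factor [expR A] restores
   [e]. *)
pose r := e / (2 * expR A).
have r0 : 0 < r by rewrite divr_gt0// mulr_gt0.
have [N mN c_tail] := bounded_sum_tail c0 cC r0.
have : (einfs (fun n => dist_to_set (x n) F) N < r%:E)%E.
  apply: (@le_lt_trans _ _ 0%E); last by rewrite lte_fin.
  (* The lower limit is the supremum of the tail infima, so each tail infimum is at most 0.
     Unfolding two infima then yields [n] and [p]. *)
  rewrite -inf0 limn_einf_lim (cvg_lim _ (@cvg_einfs_sup _ _))//.
  by apply: ereal_sup_ubound; exists N.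
move=> /ereal_inf_lt[_ [n Nn <-]] /ereal_inf_lt[_ [p Fp <-]].
rewrite lte_fin => xnp; exists p => //.
have mn : (m <= n)%N := leq_trans mN Nn.
exists n => // q /= nq; rewrite distrC.
have := @expR_recursion_bound _ (fun k => `|x k - p|) a c n q.
move=> /(_ (fun k nk => a0 k (leq_trans mn nk))).
move=> /(_ (fun k nk => c0 k (leq_trans mn nk))).
move=> /(_ (fun k nk => xS k p (leq_trans mn nk) Fp) nq).
move=> /le_lt_trans; apply.
have -> : e = expR A * (r + r).
  by rewrite /r; field; rewrite gt_eqF.
apply: (@le_lt_trans _ _ (expR A * (`|x n - p| + \sum_(n <= k < q) c k))).
  apply: ler_wpM2r.
    rewrite addr_ge0// big_nat sumr_ge0// => k /andP[nk _].
    by rewrite c0// (leq_trans mn).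
  rewrite ler_expR (le_trans _ (aA q))// (big_cat_nat mn nq)/= lerDr.
  by rewrite big_nat sumr_ge0// => k /andP[mk _]; exact: a0.
by rewrite ltr_pM2l// ltrD// c_tail.
Qed.

Lemma limn_einf_dist_eq0 (R : realType) (E : normedModType R)
    (A : set E) (x : nat -> E) p :
  A p -> x @ \oo --> p -> limn_einf (fun n => dist_to_set (x n) A) = 0%E.
Proof.
move=> Ap xp; suff /cvg_limn_einf_sup[] :
  (fun n => dist_to_set (x n) A) @ \oo --> 0%E by [].
apply: (@squeeze_cvge _ _ _ _ (cst 0%E) _ (fun n => `|x n - p|%:E)).
- near=> n; apply/andP; split.
    by apply: le_ereal_inf_tmp => _ [q _ <-]; rewrite lee_fin.
  by apply: ge_ereal_inf; exists `|x n - p|%:E => //; exists p.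
- exact: cvg_cst.
- apply: cvg_EFin; first by near=> n.
  by apply/norm_cvg0P/subr_cvg0.
Unshelve. all: by end_near. Qed.

(** * Convex combinations and iterates of [P \o T] *)

Lemma convex_set_comb (R : realType) (E : normedModType R) (K : set E)
    (t : R) (u v : E) :
  convex_set (K : set (convex_lmodType E)) -> 0 <= t <= 1 -> K u -> K v ->
  K ((1 - t) *: u + t *: v).
Proof.
move=> cK t01 Ku Kv.
have [k kt] : exists k : {i01 R}, k%:num = t.
  by exists (Itv01 (proj1 (andP t01)) (proj2 (andP t01))).
have /set_mem := cK v u k (mem_set Kv) (mem_set Ku).
by rewrite -kt addrC.
Qed.

Lemma norm_comb_le (R : realType) (E : normedModType R) (t r : R) (u v p : E) :
  0 <= t <= 1 -> `|u - p| <= r -> `|v - p| <= r ->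
  `|(1 - t) *: u + t *: v - p| <= r.
Proof.
move=> /andP[t0 t1] ur vr.
have -> : (1 - t) *: u + t *: v - p = (1 - t) *: (u - p) + t *: (v - p).
  by rewrite !scalerBr addrACA -opprD -scalerDl subrK scale1r.
rewrite (le_trans (ler_normD _ _))// !normrZ !ger0_norm ?subr_ge0//.
have : (1 - t) * `|u - p| <= (1 - t) * r by rewrite ler_wpM2l// subr_ge0.
have : t * `|v - p| <= t * r by rewrite ler_wpM2l.
lra.
Qed.

Lemma iter_range_mem (T : Type) (K : set T) (f : T -> T) n x :
  (forall z, K (f z)) -> K x -> K (iter n f x).
Proof. by move=> fK Kx; case: n => //= n; exact: fK. Qed.

Lemma tan_quasi_bound (R : realType) (E : normedModType R) (K : set E)
    (P T : E -> E) (mu lambda : nat -> R) (phi : R -> R) (M Mstar : R)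
    (n : nat) (z p : E) :
  nonexpansive_retraction K P ->
  total_asymptotically_nonexpansive K P mu lambda phi T ->
  0 <= M -> 0 <= Mstar ->
  (forall t, M <= t -> phi t <= Mstar * t) ->
  (1 <= n)%N -> K z -> fixed_points K T p ->
  `|iter n (P \o T) z - p| <=
    (1 + Mstar * mu n) * `|z - p| + (mu n * phi M + lambda n).
Proof.
move=> [_ _ PK] [mul0 _ [phi_incr _ phi0] T_tan] M0 Ms0 phi_lin n1 Kz [Kp Tp].
have [mu0 l0] := mul0 n n1.
have iter_p : iter n (P \o T) p = p.
  by elim: n {n1 mu0 l0} => //= n ->; rewrite Tp PK.
have phi_le s t : s <= t -> phi s <= phi t.
  by rewrite le_eqVlt => /orP[/eqP->//|/phi_incr/ltW].
have phiM : 0 <= phi M by rewrite -phi0 phi_le.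
have := T_tan n z p n1 Kz Kp; rewrite iter_p => /le_trans; apply.
set t := `|z - p|.
have t0 : 0 <= t by exact: normr_ge0.
have : phi t <= phi M + Mstar * t.
  (* Above [M], the linear bound suffices as [phi M] is nonnegative; below [M], monotonicity gives
     [phi t <= phi M]. *)
  have [Mt|/ltW tM] := leP M t.
    by rewrite (le_trans (phi_lin _ Mt))// lerDr.
  by rewrite (le_trans (phi_le _ _ tM))// lerDl mulr_ge0.
by move=> /(ler_wpM2l mu0); lra.
Qed.

Theorem theorem1 (R : realType) (E : completeNormedModType R)
  (K : set E) (P T1 T2 : E -> E)
  (mu lambda : nat -> R) (phi : R -> R)
  (M Mstar : R) (alpha beta : nat -> R) (x y : nat -> E)
  (K_nonempty : K !=set0)
  (K_closed : closed K)
  (K_convex : convex_set (K : set (convex_lmodType E)))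
  (P_retraction : nonexpansive_retraction K P)
  (T1_continuous : {within K, continuous T1})
  (T2_continuous : {within K, continuous T2})
  (T1_tan : total_asymptotically_nonexpansive K P mu lambda phi T1)
  (T2_tan : total_asymptotically_nonexpansive K P mu lambda phi T2)
  (mu_summable : (\sum_(1 <= n <oo) (mu n)%:E < +oo)%E)
  (lambda_summable : (\sum_(1 <= n <oo) (lambda n)%:E < +oo)%E)
  (M_gt0 : 0 < M) (Mstar_gt0 : 0 < Mstar)
  (phi_linear_growth : forall kappa : R, M <= kappa -> phi kappa <= Mstar * kappa)
  (alpha_01 : forall n, (1 <= n)%N -> 0 <= alpha n <= 1)
  (beta_01 : forall n, (1 <= n)%N -> 0 <= beta n <= 1)
  (F_nonempty : fixed_points K T1 `&` fixed_points K T2 !=set0)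
  (x1_in_K : K (x 1%N))
  (x_rec : forall n, (1 <= n)%N ->
     x n.+1 = (1 - alpha n) *: iter n (P \o T1) (y n)
              + alpha n *: iter n (P \o T2) (y n))
  (y_def : forall n, (1 <= n)%N ->
     y n = (1 - beta n) *: x n + beta n *: iter n (P \o T1) (x n)) :
  (exists2 p : E, (fixed_points K T1 `&` fixed_points K T2) p & x @ \oo --> p)
  <->
  limn_einf (fun n =>
    dist_to_set (x n) (fixed_points K T1 `&` fixed_points K T2)) = 0%E.
Proof.
set F := fixed_points K T1 `&` fixed_points K T2.
split=> [[p Fp xp]|inf0]; first exact: limn_einf_dist_eq0 Fp xp.
have [mul_ge0 _ [phi_incr _ phi0] _] := T1_tan.
have mu0 n : (1 <= n)%N -> 0 <= mu n by move=> /mul_ge0[].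
have la0 n : (1 <= n)%N -> 0 <= lambda n by move=> /mul_ge0[].
have phiM : 0 <= phi M by rewrite -phi0 ltW// phi_incr.
have [A muA] := nneseries_lt_pinfty_ub mu0 mu_summable.
have [B laB] := nneseries_lt_pinfty_ub la0 lambda_summable.
have [PK _ _] := P_retraction.
have iterK T n z : K z -> K (iter n (P \o T) z).
  by apply: iter_range_mem => u; exact: PK.
have K_y n : (1 <= n)%N -> K (x n) -> K (y n).
  move=> n1 Kx; rewrite y_def//.
  by apply: convex_set_comb; rewrite ?beta_01//; apply: iterK.
have K_x n : (1 <= n)%N -> K (x n).
  (* The induction effectively starts at 1, since [x 0] is unconstrained. *)
  elim: n => // -[//|n] IHn _; have Kx := IHn isT; have Ky := K_y n.+1 isT Kx.
  by rewrite x_rec//; apply: convex_set_comb; rewrite ?alpha_01//; apply: iterK.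
(* The 2 in [a] is the exponent in [(1 + s) ^+ 2], from two successive uses of the one-map bound;
   the 2 in [c] counts their two error terms. *)
pose a n := 2 * (Mstar * mu n).
pose c n := 2 * (mu n * phi M + lambda n).
apply: (@quasi_fejer_cvg _ _ F x a c 1 (2 * (Mstar * A))
  (2 * (A * phi M + B))) => //.
- by apply: closedI; exact: closed_fixed_points.
- by move=> n n1; rewrite !mulr_ge0 ?mu0// ltW.
- by move=> n n1; rewrite mulr_ge0// addr_ge0 ?la0// mulr_ge0 ?mu0.
- by move=> n; rewrite -mulr_sumr ler_pM2l// -mulr_sumr ler_pM2l.
- move=> n; rewrite -mulr_sumr ler_pM2l// big_split/= -mulr_suml.
  by rewrite lerD// ler_wpM2r.
move=> n p n1 [F1p F2p].
have Kx := K_x n n1; have Ky := K_y n n1 Kx.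
have T1_le z (Kz : K z) := tan_quasi_bound P_retraction T1_tan (ltW M_gt0)
  (ltW Mstar_gt0) phi_linear_growth n1 Kz F1p.
have T2_le z (Kz : K z) := tan_quasi_bound P_retraction T2_tan (ltW M_gt0)
  (ltW Mstar_gt0) phi_linear_growth n1 Kz F2p.
rewrite /a /c; set s := Mstar * mu n in T1_le T2_le *.
set w := mu n * phi M + lambda n in T1_le T2_le *.
have s0 : 0 <= s by rewrite mulr_ge0 ?mu0// ltW.
have w0 : 0 <= w by rewrite addr_ge0 ?la0// mulr_ge0 ?mu0.
have d0 : 0 <= `|x n - p| by [].
have y_le : `|y n - p| <= (1 + s) * `|x n - p| + w.
  (* Both ends of the segment must lie in the same ball around [p]; for [x n] this holds because the
     radius exceeds [|x n - p|] by a nonnegative amount. *)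
  rewrite y_def//; apply: norm_comb_le; rewrite ?beta_01 ?T1_le//.
  by rewrite mulrDl mul1r -addrA lerDl addr_ge0// mulr_ge0.
have x_le : `|x n.+1 - p| <= (1 + s) * ((1 + s) * `|x n - p| + w) + w.
  have sy_le : (1 + s) * `|y n - p| + w <= (1 + s) * ((1 + s) * `|x n - p| + w) + w.
    by rewrite lerD2r ler_wpM2l// addr_ge0.
  rewrite x_rec//; apply: norm_comb_le; rewrite ?alpha_01//.
    exact: le_trans (T1_le _ Ky) sy_le.
  exact: le_trans (T2_le _ Ky) sy_le.
have s_exp : (1 + s) ^+ 2 <= expR (2 * s).
  rewrite mulr_natl mulr2n expRD -expr2 lerXn2r ?nnegrE ?expR_ge0 ?addr_ge0//.
  exact: expR_ge1Dx.
apply: le_trans x_le _.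
apply: (@le_trans _ _ ((1 + s) ^+ 2 * (`|x n - p| + 2 * w))).
  (* The right side minus the left side is [3 * s * w + 2 * s ^+ 2 * w]. *)
  have := mulr_ge0 s0 w0; have := mulr_ge0 s0 (mulr_ge0 s0 w0); lra.
by rewrite ler_wpM2r// addr_ge0// mulr_ge0.
Qed.
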